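(* For all integers $n,m\ge 2$, the $n\times m$ grid graph $\Gamma_{n,m}$ has inspection number $\mathsf{in}(\Gamma_{n,m})=\min\{n,m\}+1$.
   Context: $\Gamma_{n,m}$ has vertex set $\{(i,j)\in\mathbb Z^2: 0\le i<n,\ 0\le j<m\}$, with $(a,b)$ and $(c,d)$ adjacent iff $|a-c|+|b-d|=1$. Zero-visibility $k$-search game on a finite simple graph $G$: an invisible intruder occupies a vertex; players alternate starting with the searcher; on each turn the searcher inspects an arbitrary set of $k$ vertices and wins if the intruder is at one of them; otherwise the intruder may move to an adjacent vertex or stay. The inspection number $\mathsf{in}(G)$ is the least $k$ for which the searcher has a finite sequence of moves guaranteeing capture regardless of the intruder's start and moves. *)

(* Defs.v *)
From mathcomp Require Import all_boot all_algebra.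
From mathcomp Require Import boolp.

Set Implicit Arguments.
Unset Strict Implicit.
Unset Printing Implicit Defensive.

Record sgraph := SGraph {
  vertex :> finType;
  adj : rel vertex;
  adj_sym : symmetric adj;
  adj_irrefl : irreflexive adj
}.

Section Search.
Variable G : sgraph.

(* [x i] is the position of the intruder at the [i]-th inspection; the searcher
   plays first, so [x 0] is inspected before the intruder ever moves. *)
Definition trajectory (x : nat -> G) : Prop :=
  forall i, x i.+1 = x i \/ adj (x i) (x i.+1).

(* The searcher gets no information before winning, so a strategy is just the
   list of successive inspections. *)
Definition guarantees_capture (S : seq {set G}) : Prop :=
  forall x, trajectory x -> exists2 i, i < size S & x i \in nth set0 S i.

Definition searcher_wins (k : nat) : Prop :=
  exists2 S : seq {set G},
    (forall A, A \in S -> #|A| = k) & guarantees_capture S.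

Lemma searcher_wins_all : searcher_wins #|G|.
Proof.
exists [:: [set: G]] => [A|x _]; first by rewrite inE => /eqP->; rewrite cardsT.
by exists 0; rewrite // inE.
Qed.

Lemma ex_searcher_wins : exists k, `[< searcher_wins k >].
Proof. by exists #|G|; apply/asboolP/searcher_wins_all. Qed.

Definition inspection_number : nat := ex_minn ex_searcher_wins.

End Search.

Section Grid.
Variables n m : nat.

(* [`|a - b|%N] is the distance in [int], not the truncated subtraction. *)
Definition grid_adj : rel ('I_n * 'I_m) :=
  fun u v => `|u.1 - v.1|%N + `|u.2 - v.2|%N == 1.

Lemma grid_adj_sym : symmetric grid_adj.
Proof. by move=> u v; rewrite /grid_adj distnC [X in _ + X]distnC. Qed.

Lemma grid_adj_irrefl : irreflexive grid_adj.
Proof. by move=> u; rewrite /grid_adj !distnn. Qed.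

Definition grid : sgraph := SGraph grid_adj_sym grid_adj_irrefl.

End Grid.

(* Main.v *)
(** Number the cells of the grid along its shorter side, whose length is [n]:
    adjacent cells get labels at distance at most [n], so inspecting the labels
    [i..i+n] at time [i] confines the intruder to labels [> i] after its move.

    Conversely, let [s = 0 + 1 + ... + (n-1)].  Any set [C] of [s] cells has at
    least [n] outer neighbours, so with [n] inspections per turn the set of
    possible positions of the intruder never drops below [s] elements.  For the
    isoperimetric bound, let [l t] be the number of columns containing more than
    [t] cells of [C] (a compression of [C] into rows).  Passing to the closed
    neighbourhood increases the [t]-th row by at least 1 when it is neither empty
    nor full, and at least to [l (t-1)].  If all rows are mixed the gain is [n];
    if there are both full and empty rows the drops add up to [m >= n];
    otherwise a gain below [n] would force [C], or its complement, to fit in a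
    triangle that is too small. *)

Require Import Defs.
From mathcomp Require Import all_boot.
From mathcomp Require Import boolp zify.

Set Implicit Arguments.
Unset Strict Implicit.
Unset Printing Implicit Defensive.

(** * Evasion from vertex expansion *)

Definition cnbhd (G : sgraph) (C : {set G}) : {set G} :=
  [set v | [exists u in C, (v == u) || adj u v]].

Lemma exists_subset_card (T : finType) (A : {set T}) (s : nat) :
  s <= #|A| -> exists2 B : {set T}, B \subset A & #|B| = s.
Proof.
move=> sA; exists [set x in take s (enum A)].
  by apply/subsetP => x; rewrite inE => /mem_take; rewrite mem_enum.
rewrite cardsE (card_uniqP _) ?take_uniq ?enum_uniq //.
by rewrite size_takel // -cardE.
Qed.

Lemma cnbhdS (G : sgraph) (B C : {set G}) :
  B \subset C -> cnbhd B \subset cnbhd C.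
Proof.
move=> BC; apply/subsetP => v; rewrite !inE => /existsP[u /andP[uB uv]].
by apply/existsP; exists u; rewrite (subsetP BC).
Qed.

(** If [C] is the set of possible positions, one inspection leaves at least [s] of them and the next
    move brings the count back to [s + k], so the invariant survives every round. The trajectory is
    built backwards: each step picks a predecessor of an evading tail. *)
Lemma expansion_evasion (G : sgraph) (s k : nat) :
    0 < s + k ->
    (forall C : {set G}, s <= #|C| -> s + k <= #|cnbhd C|) ->
  forall (S : seq {set G}) (C : {set G}),
    (forall A, A \in S -> #|A| <= k) -> s + k <= #|C| ->
  exists2 x, trajectory x &
    x 0 \in C /\ forall i, i < size S -> x i \notin nth set0 S i.
Proof.
move=> sk0 expG; elim=> [|A S IHS] C cardS sC.
  have /card_gt0P[v vC] : 0 < #|C| by exact: leq_trans sC.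
  by exists (fun=> v) => [i|]; [left | split].
have cardA : #|A| <= k by apply: cardS; rewrite mem_head.
have sCA : s <= #|C :\: A|.
  by have := subset_leq_card (subsetIr C A); rewrite cardsD; lia.
have [|x xtraj [x0 xS]] := IHS (cnbhd (C :\: A)) _ (expG _ sCA).
  by move=> B BS; apply: cardS; rewrite inE BS orbT.
move: x0; rewrite inE => /existsP[u /andP[]]; rewrite inE => /andP[uA uC] ux.
exists (fun i => if i is j.+1 then x j else u).
  case=> [|i]; last exact: xtraj.
  by case/orP: ux => [/eqP|]; [left | right].
by split=> // -[|i] // iS; exact: xS.
Qed.

(** * Upper bound: sweeping along a labelling of small bandwidth *)

Lemma bandwidth_searcher_wins (G : sgraph) (f : G -> nat) (b : nat) :
    injective f -> (forall x, f x < #|G|) ->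
    (forall x y, adj x y -> f x <= f y + b) -> b < #|G| ->
  searcher_wins G b.+1.
Proof.
move=> finj fltG fadj bG.
pose I i := [set x : G | i <= f x <= i + b].
(* The last window starts at [#|G| - b - 1] and so ends at the largest label. *)
exists (mkseq I (#|G| - b)).
  move=> A /mapP[i]; rewrite mem_iota => iG ->.
  (* The labelling is a bijection onto the labels below [#|G|], so each window has exactly [b.+1]
     vertices. *)
  pose g x : 'I_#|G| := Ordinal (fltG x).
  have ginj : injective g by move=> x y /(congr1 val) /finj.
  have [h gK hK] : bijective g by apply: inj_card_bij => //; rewrite card_ord.
  have -> : I i = h @: [set j : 'I_#|G| | i <= j <= i + b].
    apply/setP => x; rewrite inE; apply/idP/imsetP => [xI | [j + ->]].
      by exists (g x); rewrite ?gK // inE.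
    by rewrite inE -{1 2}[j]hK.
  rewrite card_imset; last exact: can_inj hK.
  rewrite cardE -(size_map val) -[RHS](size_iota i).
  apply/perm_size/uniq_perm; rewrite ?iota_uniq ?(map_inj_uniq val_inj) ?enum_uniq //.
  move=> j; rewrite mem_iota; apply/mapP/idP => [[l + ->]|jI].
    by rewrite mem_enum inE /=; lia.
  have jG : j < #|G| by lia.
  by exists (Ordinal jG); rewrite // mem_enum inE /=; lia.
move=> x xtraj; rewrite size_mkseq.
have [[i iG xI] | free] := pselect (exists2 i, i < #|G| - b & x i \in I i).
  by exists i => //; rewrite nth_mkseq.
(* An intruder missed at time [i] has label above [i + b], and a move lowers it by at most [b]. *)
have lbx i : i < #|G| - b -> i <= f (x i).
  elim: i => // i IHi iG.
  have i_le : i <= f (x i) by apply: IHi; lia.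
  have : x i \notin I i by apply/negP => xI; apply: free; exists i => //; lia.
  rewrite inE i_le /= -ltnNge => lt_f.
  by case: (xtraj i) => [-> | /fadj]; lia.
case: free; exists (#|G| - b).-1; first by lia.
have := fltG (x (#|G| - b).-1); have := lbx (#|G| - b).-1.
by rewrite inE; lia.
Qed.

Lemma searcher_wins_iso (G H : sgraph) (f : G -> H) (g : H -> G) (k : nat) :
    cancel f g -> cancel g f -> (forall u v : H, adj u v -> adj (g u) (g v)) ->
  searcher_wins G k -> searcher_wins H k.
Proof.
move=> fK gK gadj [S cardS winS]; exists [seq f @: (A : {set G}) | A <- S].
  move=> _ /mapP[A AS ->]; rewrite card_imset; last exact: can_inj fK.
  exact: cardS.
move=> x xtraj; have [|i iS xi] := winS (g \o x).
  by move=> i /=; case: (xtraj i) => [-> | /gadj]; [left | right].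
exists i; rewrite ?size_map // (nth_map set0) //.
by apply/imsetP; exists (g (x i)).
Qed.

Lemma grid_swap (n m k : nat) :
  searcher_wins (grid n m) k -> searcher_wins (grid m n) k.
Proof.
apply: (@searcher_wins_iso (grid n m) (grid m n)
          (fun u => (u.2, u.1)) (fun u => (u.2, u.1))).
- by case.
- by case.
- by move=> u v; rewrite /= /grid_adj /= addnC.
Qed.

Lemma grid_searcher_wins (n m : nat) :
  1 < n -> 1 < m -> searcher_wins (grid n m) n.+1.
Proof.
move=> n1 m1; have cardG : #|grid n m| = n * m by rewrite card_prod !card_ord.
apply: (@bandwidth_searcher_wins (grid n m) (fun u : 'I_n * 'I_m => u.2 * n + u.1)).
- move=> [i j] [i' j'] /= e.
  have n0 : 0 < n by lia.
  have ej : j = j' :> nat.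
    have /= := congr1 (divn^~ n) e.
    by rewrite !divnMDl ?divn_small ?addn0.
  have ei : i = i' :> nat by move: e; rewrite ej; lia.
  by rewrite (val_inj ei) (val_inj ej).
- move=> [i j]; rewrite cardG /=.
  by have := ltn_ord i; have := ltn_ord j; nia.
- move=> [i j] [i' j']; rewrite /= /grid_adj /=.
  have := ltn_ord i; have := ltn_ord i'.
  move=> ? ? ?.
  (* The label exceeds its neighbour's by at most 1 in the first case and by exactly [n] in the
     second. *)
  have [[? ?] | [? ?]] : (j <= j' /\ i <= i' + 1) \/ (j = j'.+1 :> nat /\ i = i' :> nat) by lia.
    by nia.
  nia.
- rewrite cardG; nia.
Qed.

(** * Closed neighbourhoods in a path *)

(* [cnbhd] for the path on ['I_n]. *)
Definition pnbhd (n : nat) (A : {set 'I_n}) : {set 'I_n} :=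
  [set i : 'I_n | [exists j in A, (i <= j.+1) && (j <= i.+1)]].

Lemma pnbhd_id (n : nat) (A : {set 'I_n}) : A \subset pnbhd A.
Proof.
by apply/subsetP => i iA; rewrite inE; apply/existsP; exists i; rewrite iA leqnSn.
Qed.

(** The path is connected, so a nonempty set equal to its closed neighbourhood is everything. *)
Lemma card_pnbhd (n : nat) (A : {set 'I_n}) :
  #|A| + (0 < #|A| < n) <= #|pnbhd A|.
Proof.
have le_card := subset_leq_card (pnbhd_id A).
case: (boolP (0 < #|A| < n)) => [/andP[/card_gt0P[i iA] ltA] | _]; last by rewrite addn0.
rewrite addn1 ltn_neqAle le_card andbT.
apply: contraTneq ltA => eqc; rewrite -leqNgt -[leqLHS]card_ord.
have AE : A = pnbhd A by apply/eqP; rewrite eqEcard pnbhd_id eqc leqnn.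
have step (j l : 'I_n) : j \in A -> l <= j.+1 -> j <= l.+1 -> l \in A.
  by move=> jA lj jl; rewrite AE inE; apply/existsP; exists j; rewrite jA lj.
(* One of the truncated differences vanishes, so [d] is the distance from [i]; the induction walks
   from [i] to [j]. *)
have near d (j : 'I_n) : (i - j) + (j - i) = d -> j \in A.
  elim: d j => [|d IHd] j dij; first by rewrite (_ : j = i) //; apply: val_inj => /=; lia.
  have := ltn_ord i; have := ltn_ord j => jn in_.
  have [lt_ij | le_ji] := ltnP i j.
    have jn' : j.-1 < n by lia.
    by apply: (step (Ordinal jn')) => /=; [apply: IHd => /= | |]; lia.
  have jn' : j.+1 < n by lia.
  by apply: (step (Ordinal jn')) => /=; [apply: IHd => /= | |]; lia.
by apply/subset_leq_card/subsetP => j _; exact: (near _ j erefl).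
Qed.

(** * Compression of a set of cells into rows *)

Section Layers.
Variables n m : nat.
Implicit Type C : {set grid n m}.

Definition column C (j : 'I_m) : {set 'I_n} := [set i | (i, j) \in C].

Definition layer C (t : nat) : {set 'I_m} := [set j | t < #|column C j|].

Lemma card_column C j : #|column C j| <= n.
Proof. by rewrite -[leqRHS]card_ord max_card. Qed.

(** Double counting: a column with [h] cells lies in exactly the layers [t < h]. *)
Lemma card_layers C : #|C| = \sum_(t < n) #|layer C t|.
Proof.
have -> : #|C| = \sum_(j < m) #|column C j|.
  rewrite -sum1_card big_mkcond /=.
  rewrite (eq_bigr (fun u : 'I_n * 'I_m => (u.1, u.2) \in C : nat)); last first.
    by move=> [i j] _ /=; case: ifP.
  rewrite -(pair_bigA _ (fun (i : 'I_n) (j : 'I_m) => (i, j) \in C : nat)) /=.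
  rewrite exchange_big; apply: eq_bigr => j _.
  by rewrite -sum1_card [RHS]big_mkcond; apply: eq_bigr => i _; rewrite inE; case: ifP.
transitivity (\sum_(j < m) \sum_(t < n) (t < #|column C j| : nat)).
  apply: eq_bigr => j _; rewrite -(big_mkord xpredT (fun t => t < _ : nat)).
  rewrite (big_cat_nat (n := #|column C j|)) ?card_column //=.
  rewrite big_nat (eq_bigr (fun=> 1)); last by move=> t /andP[_ ->].
  rewrite -big_nat sum_nat_const_nat muln1 subn0.
  rewrite [X in _ + X]big_nat big1 ?addn0 // => t /andP[].
  by rewrite leqNgt => /negbTE->.
rewrite exchange_big; apply: eq_bigr => t _.
by rewrite -sum1_card [RHS]big_mkcond; apply: eq_bigr => j _; rewrite inE; case: ifP.
Qed.

Lemma card_layer_antitone C t u : t <= u -> #|layer C u| <= #|layer C t|.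
Proof.
by move=> tu; apply/subset_leq_card/subsetP => j; rewrite !inE; exact: leq_ltn_trans.
Qed.

Lemma pnbhd_column C j : pnbhd (column C j) \subset column (cnbhd C) j.
Proof.
apply/subsetP => i; rewrite !inE => /existsP[i' /andP[]]; rewrite inE => iC ii'.
apply/existsP; exists (i', j); rewrite iC /= /grid_adj xpair_eqE -!val_eqE /=; lia.
Qed.

Lemma column_cnbhd C (j l : 'I_m) :
  j <= l.+1 -> l <= j.+1 -> column C l \subset column (cnbhd C) j.
Proof.
move=> jl lj; apply/subsetP => i; rewrite !inE => iC.
apply/existsP; exists (i, l); rewrite iC /= /grid_adj xpair_eqE -!val_eqE /=; lia.
Qed.

Lemma pnbhd_layer C t : pnbhd (layer C t) \subset layer (cnbhd C) t.
Proof.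
apply/subsetP => j; rewrite !inE => /existsP[l /andP[]]; rewrite inE => lt_t /andP[jl lj].
exact: leq_trans lt_t (subset_leq_card (column_cnbhd _ jl lj)).
Qed.

(** A nonempty column that is not full gains a cell within itself; a full one already has [n] cells,
    more than [t.+1]. *)
Lemma layer_cnbhdS C t : t.+1 < n -> layer C t \subset layer (cnbhd C) t.+1.
Proof.
move=> tn; apply/subsetP => j; rewrite !inE => lt_t.
have := subset_leq_card (pnbhd_column C j); have := card_pnbhd (column C j).
by have := card_column C j; case: (ltnP #|column C j| n); lia.
Qed.

End Layers.

(** * The inequality on row lengths *)

Lemma sum_ord_double (n : nat) : (\sum_(i < n) i).*2 + n = n * n.
Proof.
elim: n => [|n IHn]; first by rewrite big_ord0.
by rewrite big_ord_recr /=; move: (\sum_(i < n) i) IHn => s IHn; lia.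
Qed.

Lemma layer_growth (n m : nat) (l l' : nat -> nat) :
    1 < n -> n <= m ->
    (forall t u, t <= u -> l u <= l t) -> (forall t, l t <= m) ->
    (forall t, t < n -> l t + (0 < l t < m) <= l' t) ->
    (forall t, t.+1 < n -> l t <= l' t.+1) ->
    \sum_(t < n) l t = \sum_(i < n) i ->
  \sum_(i < n) i + n <= \sum_(t < n) l' t.
Proof.
move=> n1 nm lanti lm l'mid l'drop suml.
(* [W i] is the total gain of the first [i] rows; the aim is [n <= W n]. *)
pose W i := \sum_(t < i) (l' t - l t).
have WS i : W i.+1 = W i + (l' i - l i) by rewrite /W big_ord_recr.
have Wn : \sum_(t < n) l' t = \sum_(i < n) i + W n.
  rewrite -suml -big_split /=; apply: eq_bigr => t _.
  by rewrite subnKC //; apply: leq_trans (l'mid _ (ltn_ord t)); exact: leq_addr.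
rewrite Wn leq_add2l leqNgt; apply/negP => ltW.
(* Row [t.+1] gains at least [l t - l t.+1], and these drops telescope. *)
have drop i j : i <= j -> j < n -> l i + W i.+1 <= l j + W j.+1.
  move=> /subnK <-; elim: (j - i) => // d IHd; rewrite addSn => dn.
  by have := IHd (ltnW dn); have := l'drop _ dn; rewrite [W (d + i).+2]WS; lia.
have mid i j : i <= j -> j <= n ->
    (forall u, i <= u < j -> 0 < l u < m) -> W i + (j - i) <= W j.
  move=> /subnK <-; rewrite addnK; elim: (j - i) => [|d IHd] dn lmid; first by rewrite addn0.
  have lmid' u : i <= u < d + i -> 0 < l u < m by move=> ?; apply: lmid; lia.
  have lmidd : 0 < l (d + i) < m by apply: lmid; lia.
  have := IHd (ltnW dn) lmid'; have := l'mid (d + i) dn.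
  by rewrite addSn WS lmidd; lia.
have W0 : W 0 = 0 by rewrite /W big_ord0.
have sum2 := sum_ord_double n.
have [l0 | l0] := ltnP (l 0) m; have [ln | ln] := posnP (l n.-1).
(* No row is full and the last is empty. If row [i] is nonempty, rows [0..i] are mixed and gain
   [i.+1], leaving less than [n - i.+1] for the later drop [l i]. The extra 1 at [i = 0] makes the
   summed bound contradictory. *)
- have li (i : 'I_n) : l i + (i + (i == 0 :> nat)) <= n.-1.
    have := ltn_ord i => i_n.
    have [-> | li0] := posnP (l i); first by lia.
    have lmid u : 0 <= u < i.+1 -> 0 < l u < m.
      by have := lanti 0 u; have := lanti u i; lia.
    have W_ge : W 0 + (i.+1 - 0) <= W i.+1 by apply: mid.
    have : l i + W i.+1 <= l n.-1 + W n.-1.+1 by apply: drop; lia.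
    by rewrite ln prednK; lia.
  have : \sum_(i < n) (l i + (i + (i == 0 :> nat))) <= \sum_(i < n) n.-1.
    by apply: leq_sum => i _; exact: li.
  rewrite !big_split /= suml sum_nat_const card_ord.
  have : 0 < \sum_(i < n) (i == 0 :> nat).
    by rewrite (bigD1 (Ordinal (ltnW n1))).
  have : n * n.-1 + n = n * n by rewrite -mulnSr prednK //; lia.
  by move: sum2 (\sum_(i < n) (i == 0 :> nat)) => + e; move: (\sum_(i < n) i) => s; lia.
- have lmid u : 0 <= u < n -> 0 < l u < m.
    by have := lanti 0 u; have := lanti u n.-1; lia.
  by have := mid 0 n (leq0n n) (leqnn n) lmid; lia.
- have : l 0 + W 1 <= l n.-1 + W n.-1.+1 by apply: drop; lia.
  by rewrite ln prednK; lia.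
(* Row 0 is full and no row is empty. If row [i] is not full, the mixed rows after it gain
   [n - i.+1], so [W i.+1 <= i] bounds the drop [m - l i]. *)
- have li (i : 'I_n) : m <= l i + i.
    have i_n := ltn_ord i.
    have lmid u : l i < m -> i.+1 <= u < n -> 0 < l u < m.
      by have := lanti i u; have := lanti u n.-1; lia.
    have [lim | lim] := ltnP (l i) m; last by lia.
    have W_ge : W i.+1 + (n - i.+1) <= W n.
      by apply: mid => // u; exact: lmid.
    by have := drop 0 i (leq0n i) i_n; lia.
  have : \sum_(i < n) m <= \sum_(i < n) (l i + i).
    by apply: leq_sum => i _; exact: li.
  rewrite big_split /= suml sum_nat_const card_ord.
  have : n * n <= n * m by rewrite leq_mul2l nm orbT.
  by move: sum2; move: (\sum_(i < n) i) => s; lia.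
Qed.

(** * Lower bound from expansion of the grid, and conclusion *)

Lemma grid_expansion (n m : nat) (C : {set grid n m}) :
    1 < n -> n <= m -> \sum_(i < n) i <= #|C| ->
  \sum_(i < n) i + n <= #|cnbhd C|.
Proof.
(* Shrinking to exactly [\sum_(i < n) i] cells gives the equality that [layer_growth] requires. *)
move=> n1 nm /exists_subset_card[B BC cardB].
apply: leq_trans (subset_leq_card (cnbhdS BC)).
rewrite [leqRHS]card_layers.
apply: (@layer_growth n m (fun t => #|layer B t|) (fun t => #|layer (cnbhd B) t|)) => //.
- exact: card_layer_antitone.
- by move=> t; rewrite -[leqRHS]card_ord max_card.
- move=> t _; apply: leq_trans (card_pnbhd _) _.
  exact/subset_leq_card/pnbhd_layer.
- by move=> t tn; exact/subset_leq_card/layer_cnbhdS.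
- by rewrite -cardB [in RHS]card_layers.
Qed.

Lemma grid_searcher_loses (n m k : nat) :
  1 < n -> n <= m -> searcher_wins (grid n m) k -> n < k.
Proof.
move=> n1 nm [S cardS winS]; rewrite ltnNge; apply/negP => kn.
have [|C sC|||x xtraj [_ xS]] :=
    @expansion_evasion (grid n m) (\sum_(i < n) i) n _ _ S [set: grid n m].
- by lia.
- exact: grid_expansion.
- by move=> A /cardS->.
- rewrite cardsT card_prod !card_ord.
  by have := sum_ord_double n; nia.
- by have [i iS xi] := winS x xtraj; move: (xS i iS); rewrite xi.
Qed.

Lemma inspection_number_eq (G : sgraph) (k : nat) :
  searcher_wins G k -> (forall j, searcher_wins G j -> k <= j) ->
  inspection_number G = k.
Proof.
move=> wins_k kmin; rewrite /inspection_number.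
case: ex_minnP => j /asboolP wins_j jmin.
by apply/eqP; rewrite eqn_leq kmin // jmin //; apply/asboolP.
Qed.

Theorem theorem3p3 (n m : nat) (hn : 2 <= n) (hm : 2 <= m) :
  inspection_number (grid n m) = minn n m + 1.
Proof.
rewrite addn1; apply: inspection_number_eq => [|j].
  by have [_ | _] := leqP n m; [| apply: grid_swap]; apply: grid_searcher_wins.
have [nm | mn] := leqP n m; first exact: grid_searcher_loses.
by move=> /grid_swap; apply: grid_searcher_loses => //; exact: ltnW.
Qed.
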